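(* Let $0<p<1$ and let $(X_n)$ be a random Bernoulli-Fibonacci $\mathcal{BF}(p)$ sequence. Then the sequence $\left(\frac{1}{n}\log X_n\right)$ satisfies a large deviation principle with speed $n$ and good rate function $$I(p,x)=\sup_{t\in\mathbb{R}}\left\{xt-\Lambda(p,t)\right\},\qquad x\in\mathbb{R},$$ where, for any real number $t$, $\Lambda(p,t)$ (the limiting cumulant generating function, $\Lambda(p,t)=\lim_{n\to\infty}\frac1n\log\mathbb{E}[X_n^t]$) is the unique real solution $\Lambda$ of the implicit equation $$\mathbb{E}\left[F_{G+3}^{\,t}\exp\left(-(G+1)\Lambda\right)\right]=1,$$ where $(F_k)$ is the Fibonacci sequence and $G$ is a random variable with Geometric $\mathcal{G}(p)$ distribution.
   Context: Random Bernoulli-Fibonacci $\mathcal{BF}(p)$ sequence: $X_0=1$, $X_1=1$, $X_2=2$ and for all $n\geq 2$, $X_{n+1}=X_n+X_{n+\theta_{n+1}-1}$, equivalently $X_{n+1}=(1+\theta_{n+1})X_n+(1-\theta_{n+1})X_{n-1}$, where $(\theta_n)_{n\geq 3}$ is a sequence of independent Bernoulli $\mathcal{B}(p)$ random variables, $\mathbb{P}(\theta_n=1)=p=1-\mathbb{P}(\theta_n=0)$ (in particular $\theta_{n+1}$ is independent of $X_1,\ldots,X_n$). $(F_k)_{k\ge 0}$ is the classical Fibonacci sequence: $F_0=0$, $F_1=1$, $F_{k+2}=F_{k+1}+F_k$. The Geometric $\mathcal{G}(p)$ distribution is $\mathbb{P}(G=k)=p(1-p)^k$ for all $k\geq 0$.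 A sequence $(Z_n)$ of real random variables satisfies a large deviation principle with speed $n$ and good rate function $I$ if $I:\mathbb{R}\to[0,\infty]$ has compact sublevel sets $\{I\leq a\}$, $a\ge 0$, and for every closed $C\subset\mathbb{R}$, $\limsup_n \frac1n\log\mathbb{P}(Z_n\in C)\leq -\inf_{C}I$, and for every open $O\subset\mathbb{R}$, $\liminf_n\frac1n\log\mathbb{P}(Z_n\in O)\geq-\inf_O I$. *)

(* Defs.v *)
From HB Require Import structures.
From mathcomp Require Import all_boot all_order all_algebra finmap.
From mathcomp Require Import all_classical all_reals all_analysis.

Set Implicit Arguments.
Unset Strict Implicit.
Unset Printing Implicit Defensive.

Import Order.TTheory GRing.Theory Num.Theory.
Import numFieldNormedType.Exports.

Local Open Scope classical_set_scope.
Local Open Scope ring_scope.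

Fixpoint fib (k : nat) : nat :=
  match k with
  | 0 => 0
  | k1.+1 => match k1 with 0 => 1 | k2.+1 => fib k1 + fib k2 end
  end%N.

Definition mutually_independent {d d'} {T : measurableType d}
    {T' : measurableType d'} {R : realType} (P : probability T R)
    {I : choiceType} (D : set I) (Y : I -> {RV P >-> T'}) : Prop :=
  forall (s : {fset I}) (B : I -> set T'),
    [set` s] `<=` D -> (forall i, i \in s -> measurable (B i)) ->
    P (\bigcap_(i in [set` s]) (Y i @^-1` B i)) =
      (\prod_(i <- s) P (Y i @^-1` B i))%E.

(* Only the [theta n] with [3 <= n] matter; the other ones are unconstrained.
   The bool [theta n.+1 w] is read as the number 0 or 1; since [2 <= n], the
   subtraction in the index is never truncated. *)
Definition bernoulli_fibonacci {d} {T : measurableType d} {R : realType}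
    (P : probability T R) (p : R) (theta : nat -> {RV P >-> bool})
    (X : nat -> {RV P >-> R}) : Prop :=
  [/\ mutually_independent [set n | (3 <= n)%N] theta,
      forall n, (3 <= n)%N -> distribution P (theta n) =1 bernoulli_prob p,
      forall w, [/\ X 0%N w = 1, X 1%N w = 1 & X 2%N w = 2] &
      forall n w, (2 <= n)%N ->
        X n.+1 w = X n w + X (n + theta n.+1 w - 1)%N w].

Arguments bernoulli_fibonacci {d T R} P p theta X.

Definition geometric_rv {d} {T : measurableType d} {R : realType}
    (P : probability T R) (p : R) (G : {RV P >-> nat}) : Prop :=
  forall k, P (G @^-1` [set k]) = (p * (1 - p) ^+ k)%:E.

Arguments geometric_rv {d T R} P p G.

Definition good_rate_function {R : realType} (I : R -> \bar R) : Prop :=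
  (forall x, (0 <= I x)%E) /\
  (forall a : R, 0 <= a -> compact [set x | (I x <= a%:E)%E]).

(* [lne 0 = -oo] and the infimum of [I] over the empty set is [+oo]. *)
Definition large_deviation_principle {d} {T : measurableType d} {R : realType}
    (P : probability T R) (Z : nat -> T -> R) (I : R -> \bar R) : Prop :=
  [/\ forall n, measurable_fun setT (Z n),
      good_rate_function I,
      forall C : set R, closed C ->
        (limn_esup (fun n => (n%:R^-1)%:E * lne (P (Z n @^-1` C)))
          <= - ereal_inf (I @` C))%E &
      forall O : set R, open O ->
        (- ereal_inf (I @` O)
          <= limn_einf (fun n => (n%:R^-1)%:E * lne (P (Z n @^-1` O))))%E].

Definition legendre {R : realType} (f : R -> R) (x : R) : \bar R :=
  ereal_sup (range (fun t => (x * t - f t)%:E)).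

(* Main.v *)
Require Import Defs.
From HB Require Import structures.
From mathcomp Require Import all_boot all_order all_algebra finmap.
From mathcomp Require Import all_classical all_reals all_analysis.
From mathcomp Require Import measurable_realfun.
From mathcomp Require Import ring lra.

(* The pair (X_(n-1), X_n) is, up to scaling, (F_(k+2), F_(k+3)), where k is the
   number of zeros since the last one, and a one multiplies the scale by
   F_(k+3). For a solution L of the implicit equation, the function
   h(k) = sum_i p (1-p)^i F_(k+i+3)^t exp(-(i+1) L) satisfies
   exp(L) h(k) = (1-p) h(k+1) + p F_(k+3)^t h(0) with h(0) = 1, and is comparable
   to F_(k+3)^t because Fibonacci numbers are within constant factors of powers
   of the golden ratio. Comparing moments with h bounds E[X_n^t] above and below
   by constants times exp(n L). The solution L is unique by strict monotonicity,
   exists because the series ranges from 0 to +oo on its interval of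
   convergence, and is differentiable in t because it stays strictly inside that
   interval. Gartner-Ellis then gives the large deviation principle. *)

Import Order.TTheory GRing.Theory Num.Theory.
Import numFieldNormedType.Exports.

Local Open Scope classical_set_scope.
Local Open Scope ring_scope.

(** * Series *)

(** The tangent inequality at [- u], multiplied by [expR u], reads [expR u - 1 <= u * expR u].
    Bounding the last [expR u] by this same inequality when [0 <= u], and from below by [1 + u] when
    [u < 0], produces the quadratic remainder. *)
Lemma expR_le_taylor2 {R : realType} (u : R) :
  expR u <= 1 + u + u ^+ 2 * expR `|u|.
Proof.
have h : expR u - 1 <= u * expR u.
  have := ler_wpM2l (expR_ge0 u) (expR_ge1Dx (- u)).
  by rewrite -expRD subrr expR0; lra.
have := expR_ge1Dx u; have [u0|u0] := leP 0 u.
  by rewrite ger0_norm//; nra.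
rewrite ltr0_norm//.
have : 1 <= expR (- u) by rewrite leNgt expR_lt1 -leNgt; lra.
by have := expR_gt0 u; nra.
Qed.

Lemma sqr_le_expR {R : realType} (u : R) : u ^+ 2 <= 4 * expR `|u|.
Proof.
rewrite -real_normK ?num_real//; set x := `|u|.
have x0 : 0 <= x by rewrite /x.
have -> : expR x = expR (x / 2) ^+ 2 by rewrite -expRM_natl; congr expR; lra.
by have := expR_ge1Dx (x / 2); nra.
Qed.

Lemma near_le_dist {R : realType} (x e : R) : 0 < e ->
  \forall y \near x, `|y - x| <= e.
Proof.
move=> e0; apply/nbhs_ballP; exists e => //= y; rewrite /ball/= distrC.
exact: ltW.
Qed.

Lemma is_cvg_series_le_norm {R : realType} (u v : R ^nat) :
  (forall k, `|u k| <= v k) -> cvgn (series v) -> cvgn (series u).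
Proof.
move=> uv cv; apply: normed_cvg; apply: series_le_cvg cv => k //=.
exact: le_trans (uv k).
Qed.

(** The limit of a divergent series is a default value, so convergence is always carried along
    separately. *)
Definition infsum {R : realType} (u : R ^nat) : R := limn (series u).

Lemma infsum_recl {R : realType} (u : R ^nat) :
  cvgn (series (fun k => u k.+1)) ->
  infsum u = u 0%N + infsum (fun k => u k.+1).
Proof.
move=> cu; apply: cvg_lim => //; rewrite -cvg_shiftS/=.
have -> : (fun n => series u n.+1) =
          (fun n => u 0%N + series (fun k => u k.+1) n).
  by apply/funext => n; rewrite /series/= big_nat_recl.
by apply: cvgD => //; exact: cvg_cst.
Qed.

Lemma infsum_ge_head {R : realType} (u : R ^nat) :
  cvgn (series u) -> (forall k, 0 <= u k) -> u 0%N <= infsum u.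
Proof.
move=> cu u0; apply: limr_ge => //; near=> n.
rewrite /series/= big_ltn ?lerDl ?sumr_ge0//.
by near: n; exists 1%N.
Unshelve. all: by end_near. Qed.

Lemma infsum_ge0 {R : realType} (u : R ^nat) :
  cvgn (series u) -> (forall k, 0 <= u k) -> 0 <= infsum u.
Proof. by move=> cu u0; apply: le_trans (u0 0%N) _; exact: infsum_ge_head. Qed.

Lemma le_infsum {R : realType} (u v : R ^nat) :
  cvgn (series u) -> cvgn (series v) -> (forall k, u k <= v k) ->
  infsum u <= infsum v.
Proof. exact: lim_series_le. Qed.

Lemma is_cvg_infsumZ {R : realType} (a : R) (u : R ^nat) :
  cvgn (series u) -> cvgn (series (fun k => a * u k)).
Proof. exact: is_cvg_seriesZ. Qed.

Lemma infsumZ {R : realType} (a : R) (u : R ^nat) :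
  cvgn (series u) -> infsum (fun k => a * u k) = a * infsum u.
Proof. exact: lim_seriesZ. Qed.

Lemma is_cvg_infsumD {R : realType} (u v : R ^nat) :
  cvgn (series u) -> cvgn (series v) -> cvgn (series (fun k => u k + v k)).
Proof. exact: is_cvg_seriesD. Qed.

Lemma infsumD {R : realType} (u v : R ^nat) :
  cvgn (series u) -> cvgn (series v) ->
  infsum (fun k => u k + v k) = infsum u + infsum v.
Proof. exact: lim_seriesD. Qed.

Lemma lt_infsum {R : realType} (u v : R ^nat) :
  cvgn (series u) -> cvgn (series v) -> (forall k, u k <= v k) ->
  u 0%N < v 0%N -> infsum u < infsum v.
Proof.
move=> cu cv uv uv0.
have cu' : cvgn (series (fun k => -1 * u k)) by exact: is_cvg_infsumZ.
have := infsum_ge_head _ (is_cvg_infsumD _ _ cv cu').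
rewrite infsumD// infsumZ// => h; rewrite -subr_gt0 -mulN1r.
apply: lt_le_trans (h _); first by rewrite mulN1r subr_gt0.
by move=> k; rewrite mulN1r subr_ge0.
Qed.

Lemma infsum_geometric {R : realType} (a z : R) : 0 <= z < 1 ->
  infsum (fun k => a * z ^+ k) = a / (1 - z).
Proof.
move=> /andP[z0 z1]; apply/cvg_lim => //; apply: cvg_geometric_series.
by rewrite ger0_norm.
Qed.

Lemma is_cvg_infsum_geometric {R : realType} (a z : R) : 0 <= z < 1 ->
  cvgn (series (fun k => a * z ^+ k)).
Proof.
by move=> /andP[z0 z1]; apply: is_cvg_geometric_series; rewrite ger0_norm.
Qed.

(** First-order expansion at [s = 0] with a quadratic error, in place of termwise differentiation.
    The geometric decay of [w] absorbs [expR (s * v k)] for small [s], because [v] grows at most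
    linearly. *)
Lemma laplace_series_expansion {R : realType} (w v : R ^nat) (C r D : R) :
    0 <= r < 1 -> 0 < D -> (forall k, 0 <= w k <= C * r ^+ k) ->
    (forall k, `|v k| <= D * k.+1%:R) ->
  [/\ cvgn (series w), cvgn (series (fun k => w k * v k)) &
    exists s1 M : R, [/\ 0 < s1, 0 <= M & forall s : R, `|s| <= s1 ->
      [/\ cvgn (series (fun k => w k * expR (s * v k))),
       (infsum w) + s * (infsum (fun k => w k * v k))
         <= (infsum (fun k => w k * expR (s * v k))) &
       (infsum (fun k => w k * expR (s * v k)))
         <= (infsum w) + s * (infsum (fun k => w k * v k))
            + M * s ^+ 2]]].
Proof.
move=> /andP[r0 r1] D0 hw hv.
(* This makes [2 * s1 * D = (1 - r) / 2], and [r * expR ((1 - r) / 2) <= 2 * r / (1 + r) < 1]. In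
   the exponent [2 * s1], one [s1] pays for the factor [(s * v k) ^+ 2], the other for the
   exponential in the Taylor remainder. *)
pose s1 : R := (1 - r) / (4 * D).
have s10 : 0 < s1 by rewrite divr_gt0//; lra.
pose rho := r * expR (2 * s1 * D).
have rho0 : 0 <= rho by rewrite mulr_ge0// expR_ge0.
have rho1 : rho < 1.
  have : 1 - 2 * s1 * D <= expR (- (2 * s1 * D)).
    by have := expR_ge1Dx (- (2 * s1 * D)).
  have -> : 2 * s1 * D = (1 - r) / 2 by rewrite /s1; field; lra.
  rewrite /rho (_ : 2 * s1 * D = (1 - r) / 2); last by rewrite /s1; field; lra.
  rewrite expRN => h; have := expR_gt0 ((1 - r) / 2) => e0.
  have : (1 - (1 - r) / 2) * expR ((1 - r) / 2) <= 1.
    by rewrite -ler_pdivlMr// div1r.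
  by nra.
pose g k := C * expR (2 * s1 * D) * rho ^+ k.
have cg : cvgn (series g).
  by apply: is_cvg_infsum_geometric; rewrite rho0.
have wg k : w k * expR (2 * s1 * `|v k|) <= g k.
  have [/andP[w0 wC] vk] := (hw k, hv k).
  have : expR (2 * s1 * `|v k|) <= expR (2 * s1 * D) * expR (2 * s1 * D) ^+ k.
    rewrite -expRM_natl -expRD ler_expR.
    have -> : 2 * s1 * D + k%:R * (2 * s1 * D) = 2 * s1 * (D * k.+1%:R).
      by rewrite -natr1; ring.
    by apply: ler_wpM2l => //; lra.
  have -> : g k = C * r ^+ k * (expR (2 * s1 * D) * expR (2 * s1 * D) ^+ k).
    by rewrite /g /rho exprMn; ring.
  by move=> h; apply: ler_pM => //; exact: expR_ge0.
have w0 k : 0 <= w k by have /andP[] := hw k.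
have one_le k : 1 <= expR (2 * s1 * `|v k|).
  by rewrite leNgt expR_lt1 -leNgt mulr_ge0//; lra.
have cw : cvgn (series w).
  apply: is_cvg_series_le_norm cg => k; rewrite ger0_norm//.
  by apply: le_trans (wg k); rewrite ler_peMr.
have cwv : cvgn (series (fun k => w k * v k)).
  have cg' := is_cvg_infsumZ s1^-1 _ cg.
  apply: is_cvg_series_le_norm cg' => k.
  rewrite normrM ger0_norm//.
  have : s1 * `|v k| <= expR (2 * s1 * `|v k|).
    apply: (@le_trans _ _ (1 + (2 * s1 * `|v k|))); last exact: expR_ge1Dx.
    have : 0 <= s1 * `|v k| by rewrite mulr_ge0//; lra.
    by lra.
  move=> h; rewrite ler_pdivlMl//.
  apply: le_trans (wg k); rewrite mulrCA; exact: ler_wpM2l.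
split => //; exists s1, (4 / s1 ^+ 2 * (infsum g)); split => //.
  apply: mulr_ge0; first by rewrite divr_ge0// sqr_ge0.
  apply: infsum_ge0 => // k; apply: le_trans (wg k).
  by rewrite mulr_ge0// expR_ge0.
move=> s ss1.
have sv k : `|s * v k| <= s1 * `|v k|.
  by rewrite normrM ler_wpM2r.
have ce : cvgn (series (fun k => w k * expR (s * v k))).
  apply: is_cvg_series_le_norm cg => k.
  rewrite ger0_norm; last by rewrite mulr_ge0// expR_ge0.
  apply: le_trans (wg k); apply: ler_wpM2l => //; rewrite ler_expR.
  apply: le_trans (ler_norm _) _; apply: le_trans (sv k) _.
  by rewrite ler_wpM2r//; lra.
have cs := is_cvg_infsumZ s _ cwv.
rewrite -infsumZ// -infsumD//; split => //.
  apply: le_infsum => //; first exact: is_cvg_infsumD.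
  move=> k; rewrite mulrCA -[X in X + _]mulr1 -mulrDr.
  by apply: ler_wpM2l => //; exact: expR_ge1Dx.
rewrite mulrAC -infsumZ// -infsumD//; last 2 first.
  exact: is_cvg_infsumD.
  exact: is_cvg_infsumZ.
apply: le_infsum => //.
  by apply: is_cvg_infsumD; [exact: is_cvg_infsumD|exact: is_cvg_infsumZ].
move=> k; rewrite (_ : w k + s * (w k * v k) = w k * (1 + s * v k)); last ring.
apply: (@le_trans _ _ (w k * (1 + s * v k +
    4 / s1 ^+ 2 * s ^+ 2 * expR (2 * s1 * `|v k|)))).
  apply: ler_wpM2l => //; apply: le_trans (expR_le_taylor2 _) _.
  rewrite lerD2l.
  have -> : (s * v k) ^+ 2 = s ^+ 2 / s1 ^+ 2 * (s1 * v k) ^+ 2.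
    by field; lra.
  have -> : 4 / s1 ^+ 2 * s ^+ 2 * expR (2 * s1 * `|v k|) =
      s ^+ 2 / s1 ^+ 2 * (4 * expR (s1 * `|v k|)) * expR (s1 * `|v k|).
    rewrite (_ : 2 * s1 * `|v k| = s1 * `|v k| + s1 * `|v k|); last by ring.
    by rewrite expRD; ring.
  have q0 : 0 <= s ^+ 2 / s1 ^+ 2 by rewrite divr_ge0 ?sqr_ge0.
  apply: ler_pM; rewrite ?expR_ge0// ?ler_expR//.
    by rewrite mulr_ge0 ?sqr_ge0.
  apply: ler_wpM2l => //; apply: le_trans (sqr_le_expR _) _.
  by rewrite normrM gtr0_norm.
rewrite [leLHS]mulrDr lerD2l mulrCA; apply: ler_wpM2l => //.
by rewrite mulr_ge0 ?divr_ge0 ?sqr_ge0.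
Qed.

(** * The implicit equation *)

Definition golden {R : realType} : R := (1 + Num.sqrt 5) / 2.

Lemma golden_sqr {R : realType} : (golden : R) ^+ 2 = golden + 1.
Proof.
have : Num.sqrt 5 ^+ 2 = 5 :> R by rewrite sqr_sqrtr.
by rewrite /golden; nra.
Qed.

Lemma golden_gt1 {R : realType} : 1 < (golden : R) < 2.
Proof.
have : Num.sqrt 5 ^+ 2 = 5 :> R by rewrite sqr_sqrtr.
have : 0 <= Num.sqrt 5 :> R by exact: sqrtr_ge0.
by rewrite /golden => h0 h1; apply/andP; split; nra.
Qed.

Lemma fibSS k : fib k.+2 = (fib k.+1 + fib k)%N. Proof. by []. Qed.

(** Powers of the golden ratio satisfy the Fibonacci recurrence, so both bounds propagate from
    [F_3 = 2] and [F_4 = 3]. *)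
Lemma fib_golden_bounds {R : realType} k :
  (golden : R) ^+ k.+1 <= (fib (k + 3))%:R <= (golden : R) ^+ k.+2.
Proof.
have g2 := @golden_sqr R; have /andP[g1 g3] := @golden_gt1 R.
rewrite addn3; elim/ltn_ind: k => -[|[|k]] IH.
- by rewrite expr1 g2 (_ : fib 3 = 2%N)//; apply/andP; split; lra.
- rewrite g2 (_ : fib 4 = 3%N)// exprS g2.
  by apply/andP; split; [lra|nra].
- have /andP[a1 b1] := IH k.+1 (ltnSn _).
  have /andP[a2 b2] := IH k (ltnW (ltnSn _)).
  rewrite fibSS natrD.
  have S j : (golden : R) ^+ j.+2 = golden ^+ j.+1 + golden ^+ j.
    by rewrite -addn2 exprD g2 mulrDr mulr1 -exprSr.
  by rewrite (S k.+1) (S k.+2); apply/andP; split; apply: lerD.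
Qed.

(** Logarithms turn [F_(k+3)^t] into an exponential linear in [t], the form that
    [laplace_series_expansion] handles. *)
Definition lnfib {R : realType} (k : nat) : R := ln (fib (k + 3))%:R.

Definition lngolden {R : realType} : R := ln golden.

Lemma fib_gt0 k : (0 < fib k.+1)%N.
Proof.
elim/ltn_ind: k => -[//|k] IH; rewrite fibSS addn_gt0.
by rewrite IH.
Qed.

Lemma expR_lnfib {R : realType} (t : R) k :
  expR (t * lnfib k) = (fib (k + 3))%:R `^ t.
Proof. by rewrite /powR ifF// pnatr_eq0 addn3 gtn_eqF// fib_gt0. Qed.

Lemma lngolden_gt0 {R : realType} : 0 < lngolden :> R.
Proof. by apply: ln_gt0; have /andP[] := @golden_gt1 R. Qed.

Lemma lnfib_bounds {R : realType} k :
  0 <= (lnfib k : R) - k.+1%:R * lngolden <= lngolden.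
Proof.
have g0 : 0 < (golden : R) by have /andP[h _] := @golden_gt1 R; lra.
have /andP[h1 h2] := @fib_golden_bounds R k.
have lnX n : ln ((golden : R) ^+ n) = n%:R * lngolden.
  by rewrite lnXn// mulr_natl.
have f0 : 0 < (fib (k + 3))%:R :> R by rewrite ltr0n addn3 fib_gt0.
have : ln ((golden : R) ^+ k.+1) <= lnfib k.
  by rewrite ler_ln ?posrE ?exprn_gt0.
have : lnfib k <= ln ((golden : R) ^+ k.+2).
  by rewrite ler_ln ?posrE ?exprn_gt0.
rewrite !lnX -(natr1 k.+1) => a1 a2; apply/andP; split; lra.
Qed.

Lemma lnfib_ge0 {R : realType} k : 0 <= lnfib k :> R.
Proof.
have /andP[h _] := @lnfib_bounds R k; have := @lngolden_gt0 R.
have : 0 <= k.+1%:R :> R by []. by nra.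
Qed.

(** Each [lnfib] exceeds a linear function of its index by an amount in [[0, lngolden]], so
    increments are linear up to [lngolden], uniformly in [k]. *)
Lemma lnfib_shift {R : realType} (t : R) k i :
  `|t * lnfib (k + i) - t * lnfib k - i%:R * (t * lngolden)|
  <= `|t| * lngolden.
Proof.
have -> : t * lnfib (k + i) - t * lnfib k - i%:R * (t * lngolden) =
    t * (lnfib (k + i) - lnfib k - i%:R * lngolden) by ring.
rewrite normrM ler_wpM2l// ler_norml.
have /andP[h1 h2] := @lnfib_bounds R k.
have /andP[h3 h4] := @lnfib_bounds R (k + i).
have : (k + i).+1%:R = k.+1%:R + i%:R :> R by rewrite -natrD addSn.
move=> e; rewrite e in h3 h4; apply/andP; split; lra.
Qed.

(** The contribution of the event [G = k] to the expectation in the implicit equation. *)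
Definition renewal_term {R : realType} (p t L : R) (k : nat) : R :=
  p * (1 - p) ^+ k * expR (t * lnfib k - k.+1%:R * L).

(* The terms behave like exp(abscissa - L)^k, so the series converges exactly
   when [abscissa p t < L]. *)
Definition abscissa {R : realType} (p t : R) : R := ln (1 - p) + t * lngolden.

(** * The series of the implicit equation as a function of t and L *)

Section renewal.
Context {R : realType} (p : R) (hp : 0 < p < 1).
Implicit Types t L : R.

Local Notation term := (renewal_term p).

Lemma renewal_term_gt0 t L k : 0 < term t L k.
Proof.
have /andP[p0 p1] := hp.
by rewrite /renewal_term !mulr_gt0 ?expR_gt0 ?exprn_gt0//; lra.
Qed.

Lemma renewal_ratioE t L : (1 - p) * expR (t * lngolden - L) =
  expR (abscissa p t - L).
Proof.
have /andP[p0 p1] := hp.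
by rewrite /abscissa -addrA [in RHS]expRD lnK// posrE; lra.
Qed.

(** Two geometric sequences with the same ratio enclose the terms: the upper one gives convergence
    above the abscissa, the lower one makes the sum large near it. *)
Lemma renewal_term_bounds t L k :
  p * expR (t * lngolden - L - `|t| * lngolden) * expR (abscissa p t - L) ^+ k
    <= term t L k <=
  p * expR (t * lngolden - L + `|t| * lngolden) * expR (abscissa p t - L) ^+ k.
Proof.
have /andP[p0 p1] := hp.
have E x : p * expR (t * lngolden - L + x) * expR (abscissa p t - L) ^+ k =
    p * (1 - p) ^+ k * expR (k.+1%:R * (t * lngolden - L) + x).
  rewrite -renewal_ratioE exprMn -expRM_natl -(natr1 k).
  rewrite (_ : _ * (_ - _) + x =
    (t * lngolden - L + x) + k%:R * (t * lngolden - L)); last by ring.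
  by rewrite [in RHS]expRD; ring.
rewrite !E /renewal_term.
have q0 : 0 < p * (1 - p) ^+ k by rewrite mulr_gt0 ?exprn_gt0//; lra.
have h : `|t * lnfib k - k.+1%:R * (t * lngolden)| <= `|t| * lngolden.
  have -> : t * lnfib k - k.+1%:R * (t * lngolden) =
    t * (lnfib k - k.+1%:R * lngolden) by ring.
  rewrite normrM ler_wpM2l// ger0_norm.
    by have /andP[] := @lnfib_bounds R k.
  by have /andP[] := @lnfib_bounds R k.
move: h; rewrite ler_norml => /andP[h1 h2].
by rewrite !ler_pM2l// !ler_expR; apply/andP; split; nra.
Qed.

(** Moving [(t, L)] in a direction [(a, y)] multiplies each term by an exponential in [s], so one
    expansion serves all directions. *)
Lemma renewal_term_perturb t L (s a y : R) k :
  term (t + s * a) (L + s * y) k =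
  term t L k * expR (s * (a * lnfib k - k.+1%:R * y)).
Proof. by rewrite /renewal_term -[RHS]mulrA -expRD; congr (_ * expR _); ring. Qed.

Lemma renewal_term_dominated t L : abscissa p t < L ->
  exists C r, 0 <= r < 1 /\ forall k, 0 <= term t L k <= C * r ^+ k.
Proof.
move=> aL.
exists (p * expR (t * lngolden - L + `|t| * lngolden)), (expR (abscissa p t - L)).
rewrite expR_ge0 expR_lt1 subr_lt0 aL; split => // k.
by rewrite ltW ?renewal_term_gt0//; have /andP[] := renewal_term_bounds t L k.
Qed.

Lemma lnfib_linear_bound (a y : R) : exists2 D : R, 0 < D &
  forall k, `|a * lnfib k - k.+1%:R * y| <= D * k.+1%:R.
Proof.
have g0 := @lngolden_gt0 R.
exists (`|a| * (2 * lngolden) + `|y| + 1).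
  by have := normr_ge0 a; have := normr_ge0 y; nra.
move=> k; apply: le_trans (ler_normB _ _) _.
rewrite !normrM (ger0_norm (lnfib_ge0 k)) (ger0_norm (ler0n _ _)).
have /andP[_ h] := @lnfib_bounds R k.
have k1 : 1 <= k.+1%:R :> R by rewrite ler1n.
have : (lnfib k : R) <= 2 * lngolden * k.+1%:R.
  by have := ler_wpM2r (ltW g0) k1; lra.
move/(ler_wpM2l (normr_ge0 a)) => h'.
by have := normr_ge0 y; nra.
Qed.

Lemma renewal_expansion t L (a y : R) : abscissa p t < L ->
  [/\ cvgn (series (term t L)),
      cvgn (series (fun k => term t L k * (a * lnfib k - k.+1%:R * y))) &
    exists s1 M : R, [/\ 0 < s1, 0 <= M & forall s : R, `|s| <= s1 ->
     [/\ cvgn (series (term (t + s * a) (L + s * y))),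
      (infsum (term t L)) +
        s * (infsum (fun k => term t L k * (a * lnfib k - k.+1%:R * y)))
        <= (infsum (term (t + s * a) (L + s * y))) &
      (infsum (term (t + s * a) (L + s * y))) <=
      (infsum (term t L)) +
        s * (infsum (fun k => term t L k * (a * lnfib k - k.+1%:R * y)))
        + M * s ^+ 2]]].
Proof.
move=> /renewal_term_dominated[C [r [r01 hw]]].
have [D D0 hv] := lnfib_linear_bound a y.
have [c1 c2 [s1 [M [s10 M0 h]]]] := laplace_series_expansion _ _ _ _ _ r01 D0 hw hv.
split; [exact: c1|exact: c2|exists s1, M; split; [by []|by []|move=> s /h]].
have <- // : term (t + s * a) (L + s * y) =
  (fun k => term t L k * expR (s * (a * lnfib k - k.+1%:R * y))).
by apply/funext => k; exact: renewal_term_perturb.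
Qed.

Lemma is_cvg_renewal t L : abscissa p t < L -> cvgn (series (term t L)).
Proof. by case/(renewal_expansion _ _ 0 0). Qed.

(** The assumption is convergence at [L] rather than [abscissa p t < L], since convergence is what
    an arbitrary solution of the implicit equation provides. *)
Lemma renewal_sum_decreasing t L L' : L < L' ->
  cvgn (series (term t L)) ->
  (infsum (term t L')) < (infsum (term t L)).
Proof.
move=> LL' cL.
have lt k : term t L' k < term t L k.
  rewrite /renewal_term ltr_pM2l; last first.
    have /andP[p0 p1] := hp.
    by rewrite mulr_gt0 ?exprn_gt0//; lra.
  by rewrite ltr_expR ltrD2l ltrN2 ltr_pM2l.
have cL' : cvgn (series (term t L')).
  apply: is_cvg_series_le_norm cL => k.
  by rewrite gtr0_norm ?renewal_term_gt0// ltW.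
by apply: lt_infsum => // k; exact: ltW.
Qed.

Lemma renewal_sum_continuous t L : abscissa p t < L ->
  {for L, continuous (fun L => (infsum (term t L)))}.
Proof.
move=> /(renewal_expansion _ _ 0 1)[_ _ [s1 [M [s10 M0 h]]]].
set V := (infsum (fun k => term t L k * (0 * lnfib k - k.+1%:R * 1))) in h.
apply/cvgrPdist_le => e e0.
(* A Lipschitz constant at [L] on the radius [s1]; the summand 1 keeps it positive. *)
pose K := `|V| + M * s1 + 1.
have K0 : 0 < K by have := normr_ge0 V; rewrite /K; nra.
near=> y.
have ys : `|y - L| <= s1.
  by near: y; exact: near_le_dist.
have ye : `|y - L| <= e / K.
  by near: y; apply: near_le_dist; rewrite divr_gt0.
have [_] := h _ ys; rewrite mulr0 addr0 mulr1 subrKC => h1 h2.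
set f := infsum (term t L) in h1 *; set g := infsum _ in h1 h2 *.
rewrite -/f in h2.
have : `|g - f| <= `|y - L| * K.
  have : `|(y - L) * V| <= `|y - L| * `|V| by rewrite normrM.
  have : M * (y - L) ^+ 2 <= M * (`|y - L| * s1).
    by rewrite ler_wpM2l// -real_normK ?num_real// expr2 ler_wpM2l.
  rewrite !ler_norml /K => a1 /andP[a2 a3].
  have := normr_ge0 (y - L) => a4; have : 0 <= M * (y - L) ^+ 2.
    by rewrite mulr_ge0 ?sqr_ge0.
  by move=> a5; apply/andP; split; lra.
rewrite distrC => h3; apply: (le_trans h3).
by rewrite -ler_pdivlMr.
Unshelve. all: by end_near. Qed.

(** Intermediate value theorem between a point [a] close to the abscissa, where the sum is at least
    1, and a point [b] where it is at most 1. *)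
Lemma renewal_solution t :
  exists2 L, abscissa p t < L & (infsum (term t L)) = 1.
Proof.
have /andP[p0 p1] := hp.
set L0 := abscissa p t.
(* A lower prefactor of the terms valid for all [L] up to [L0 + 1]. With [a - L0 <= c0], the
   geometric sum is at least [c0 / (a - L0) >= 1]. *)
pose c0 := p * expR (t * lngolden - L0 - 1 - `|t| * lngolden).
have c00 : 0 < c0 by rewrite mulr_gt0// expR_gt0.
pose a := L0 + Num.min 1 c0.
have m0 : 0 < Num.min 1 c0 by rewrite lt_min ltr01.
have La : L0 < a by rewrite /a; lra.
(* Ratio at most 1/2 and prefactor at most [p / 2], hence a sum at most [p]. *)
pose b := Num.max a (Num.max (L0 + ln 2) (t * lngolden + `|t| * lngolden + ln 2)).
have ab : a <= b by rewrite /b le_max lexx.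
have fa : 1 <= (infsum (term t a)).
  have r01 : 0 <= expR (L0 - a) < 1 by rewrite expR_ge0 expR_lt1; lra.
  apply: (@le_trans _ _ (c0 / (1 - expR (L0 - a)))).
    move/andP : r01 => [r0 r1].
    rewrite ler_pdivlMr ?mul1r; last by lra.
    have := expR_ge1Dx (L0 - a).
    have : Num.min 1 c0 <= c0 by rewrite ge_min lexx orbT.
    by rewrite /a; lra.
  rewrite -(infsum_geometric _ _ r01); apply: le_infsum.
  - exact: is_cvg_infsum_geometric.
  - exact: is_cvg_renewal.
  move=> k; have /andP[h _] := renewal_term_bounds t a k; apply: le_trans h.
  rewrite ler_wpM2r ?exprn_ge0 ?expR_ge0// ler_pM2l// ler_expR.
  have : Num.min 1 c0 <= 1 by rewrite ge_min lexx.
  by rewrite /a; lra.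
have fb : (infsum (term t b)) <= 1.
  have l2 : expR (- ln 2) = 2^-1 :> R by rewrite expRN lnK// posrE.
  have bE1 : L0 + ln 2 <= b by rewrite /b !le_max lexx/= orbT.
  have bE2 : t * lngolden + `|t| * lngolden + ln 2 <= b.
    by rewrite /b !le_max lexx/= !orbT.
  have h0 : expR (L0 - b) <= 2^-1 by rewrite -l2 ler_expR; lra.
  have r01 : 0 <= expR (L0 - b) < 1 by rewrite expR_ge0/=; lra.
  apply: (@le_trans _ _ (p * 2^-1 / (1 - expR (L0 - b)))).
    rewrite -(infsum_geometric _ _ r01); apply: le_infsum.
    - by apply: is_cvg_renewal; exact: lt_le_trans ab.
    - exact: is_cvg_infsum_geometric.
    move=> k; have /andP[_ h] := renewal_term_bounds t b k.
    apply: (le_trans h).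
    rewrite ler_wpM2r ?exprn_ge0 ?expR_ge0// ler_pM2l// -l2 ler_expR.
    by lra.
  by rewrite ler_pdivrMr; lra.
have [L] : exists2 c, c \in `[a, b] & (infsum (term t c)) = 1.
  apply: IVT => //.
    apply: continuous_in_subspaceT => y; rewrite inE/= in_itv/= => /andP[ay _].
    by apply: renewal_sum_continuous; exact: lt_le_trans ay.
  by rewrite ge_min le_max fa fb orbT.
rewrite in_itv/= => /andP[aL _] fL; exists L => //; exact: lt_le_trans aL.
Qed.

(** An implicit function argument giving the derivative [V / N]. Along the lines of slope
    [V / N + e] and [V / N - e] through [(t, L)], the sum has first-order coefficients [- (e * N)]
    and [e * N]; it therefore leaves 1 on opposite sides, and monotonicity in [L] traps
    [Lam (t + h)] between the two lines. *)
Lemma renewal_root_derivable (Lam : R -> R) :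
  (forall t, abscissa p t < Lam t) ->
  (forall t, (infsum (term t (Lam t))) = 1) ->
  forall t, derivable Lam t 1.
Proof.
move=> aLam sLam t.
set L := Lam t.
have [c cN _] := renewal_expansion _ _ 0 (- 1) (aLam t).
have [_ cV _] := renewal_expansion _ _ 1 0 (aLam t).
rewrite -/L in c cN cV.
have cN' : cvgn (series (fun k => term t L k * k.+1%:R)).
  suff <- : (fun k => term t L k * (0 * lnfib k - k.+1%:R * -1)) =
            (fun k => term t L k * k.+1%:R) by [].
  by apply/funext => k; ring.
have cV' : cvgn (series (fun k => term t L k * lnfib k)).
  suff <- : (fun k => term t L k * (1 * lnfib k - k.+1%:R * 0)) =
            (fun k => term t L k * lnfib k) by [].
  by apply/funext => k; ring.
set N := (infsum (fun k => term t L k * k.+1%:R)).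
set V := (infsum (fun k => term t L k * lnfib k)).
have N0 : 0 < N.
  apply: lt_le_trans (infsum_ge_head _ cN' _).
    by rewrite mulr_gt0// renewal_term_gt0.
  by move=> k; rewrite mulr_ge0// ltW// renewal_term_gt0.
have lin y : (infsum (fun k => term t L k * (1 * lnfib k - k.+1%:R * y)))
    = V - y * N.
  rewrite -mulNr -infsumZ// -infsumD//; last exact: is_cvg_infsumZ.
  by congr infsum; apply/funext => k; ring.
have lam_le t' L' : cvgn (series (term t' L')) -> (infsum (term t' L')) <= 1 ->
    Lam t' <= L'.
  move=> cL' s1; rewrite leNgt; apply/negP => lt.
  have := renewal_sum_decreasing _ _ _ lt cL'.
  by rewrite sLam; lra.
have lam_ge t' L' : 1 <= (infsum (term t' L')) -> L' <= Lam t'.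
  move=> s1; rewrite leNgt; apply/negP => lt.
  have := renewal_sum_decreasing _ _ _ lt (is_cvg_renewal _ _ (aLam t')).
  by rewrite sLam; lra.
have main (e : R) : 0 < e ->
    \forall h \near (0 : R)^', `|h^-1 * (Lam (t + h) - L) - V / N| <= e.
  move=> e0.
  have [_ _ [s1 [M1 [s10 M10 exp1]]]] :=
    renewal_expansion _ _ 1 (V / N + e) (aLam t).
  have [_ _ [s2 [M2 [s20 M20 exp2]]]] :=
    renewal_expansion _ _ 1 (V / N - e) (aLam t).
  have E1 : V - (V / N + e) * N = - (e * N) by field; lra.
  have E2 : V - (V / N - e) * N = e * N by field; lra.
  have eN : 0 < e * N by exact: mulr_gt0.
  (* For [|h|] below the last two bounds the linear term [e * N * |h|] dominates the errors
     [M1 * h ^+ 2] and [M2 * h ^+ 2]. *)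
  pose del := Num.min (Num.min s1 s2)
    (Num.min (e * N / (M1 + 1)) (e * N / (M2 + 1))).
  have del0 : 0 < del by rewrite !lt_min s10 s20 !divr_gt0//; lra.
  have : \forall h \near (0 : R)^', `|h - 0| <= del.
    exact: nbhs_dnbhs (near_le_dist _ _ del0).
  have : \forall h \near (0 : R)^', h != 0 by exact: nbhs_dnbhs_neq.
  apply: filterS2 => h h0; rewrite subr0.
  rewrite /del !le_min => /andP[/andP[hs1 hs2] /andP[hm1 hm2]].
  rewrite ler_pdivlMr in hm1; last by lra.
  rewrite ler_pdivlMr in hm2; last by lra.
  have [c1] := exp1 _ hs1; have [c2] := exp2 _ hs2.
  rewrite mulr1 in c1 c2 *.
  rewrite !lin sLam E1 E2 -!/L => a1 a2 b1 b2; rewrite -/L in c1 c2.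
  have key : `|Lam (t + h) - L - h * (V / N)| <= e * `|h|.
    have := h0; rewrite neq_lt => /orP[hn|hp'].
      rewrite !(ltr0_norm hn) in hm1 hm2 *.
      have l1 : L + h * (V / N + e) <= Lam (t + h) by apply: lam_ge; nra.
      have l2 : Lam (t + h) <= L + h * (V / N - e) by apply: lam_le => //; nra.
      by rewrite ler_norml; apply/andP; split; lra.
    rewrite !(gtr0_norm hp') in hm1 hm2 *.
    have l1 : L + h * (V / N - e) <= Lam (t + h) by apply: lam_ge; nra.
    have l2 : Lam (t + h) <= L + h * (V / N + e) by apply: lam_le => //; nra.
    by rewrite ler_norml; apply/andP; split; lra.
  have -> : h^-1 * (Lam (t + h) - L) - V / N =
      (Lam (t + h) - L - h * (V / N)) / h by field; rewrite h0; lra.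
  by rewrite normrM normfV ler_pdivrMr ?normr_gt0.
apply/cvg_ex; exists (V / N); apply/cvgrPdist_le => e e0.
near=> h.
rewrite distrC /= [_%:A]mulr1 [h + t]addrC; near: h; exact: main.
Unshelve. all: by end_near. Qed.
End renewal.

(** * The Gartner-Ellis theorem *)

Lemma limn_esup_le_near {R : realType} (u : nat -> \bar R) (x : \bar R) :
  (\forall n \near \oo, (u n <= x)%E) -> (limn_esup u <= x)%E.
Proof.
move=> ux; rewrite /limn_esup limf_esupE.
apply: (@le_trans _ _ (ereal_sup [set u n | n in [set n | (u n <= x)%E]])).
  by apply: ereal_inf_lbound; exists [set n | (u n <= x)%E].
by apply: ge_ereal_sup => _ [n /= h <-].
Qed.

Lemma limn_einf_ge_near {R : realType} (u : nat -> \bar R) (x : \bar R) :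
  (\forall n \near \oo, (x <= u n)%E) -> (x <= limn_einf u)%E.
Proof.
move=> ux; rewrite /limn_einf leeNr; apply: limn_esup_le_near.
by apply: filterS ux => n; rewrite leeN2.
Qed.

Lemma lne_scaled_le {R : realType} (n : nat) (a g : R) (q : \bar R) :
  (0 < n)%N -> 0 < a -> (0 <= q <= (a * expR (n%:R * g))%:E)%E ->
  ((n%:R^-1)%:E * lne q <= (n%:R^-1 * ln a + g)%:E)%E.
Proof.
move=> n0 a0 /andP[q0 qa].
have n0' : 0 < n%:R :> R by rewrite ltr0n.
have -> : n%:R^-1 * ln a + g = n%:R^-1 * ln (a * expR (n%:R * g)).
  by rewrite lnM ?posrE ?expR_gt0// expRK; field; lra.
rewrite EFinM lee_pmul2l ?lte_fin ?invr_gt0//.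
rewrite -lne_EFin ?mulr_gt0 ?expR_gt0// lee_lne// in_itv/= leey andbT//.
by rewrite lee_fin ltW// mulr_gt0 ?expR_gt0.
Qed.

Lemma lne_scaled_ge {R : realType} (n : nat) (a g : R) (q : \bar R) :
  (0 < n)%N -> 0 < a -> ((a * expR (n%:R * g))%:E <= q)%E ->
  ((n%:R^-1 * ln a + g)%:E <= (n%:R^-1)%:E * lne q)%E.
Proof.
move=> n0 a0 qa.
have n0' : 0 < n%:R :> R by rewrite ltr0n.
have -> : n%:R^-1 * ln a + g = n%:R^-1 * ln (a * expR (n%:R * g)).
  by rewrite lnM ?posrE ?expR_gt0// expRK; field; lra.
have h0 : (0 <= (a * expR (n%:R * g))%:E)%E.
  by rewrite lee_fin ltW// mulr_gt0 ?expR_gt0.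
rewrite EFinM lee_pmul2l ?lte_fin ?invr_gt0//.
rewrite -lne_EFin ?mulr_gt0 ?expR_gt0// lee_lne// in_itv/= leey andbT//.
exact: le_trans qa.
Qed.

Lemma near_div_small {R : realType} (a e : R) : 0 < e ->
  \forall n \near \oo, `|n%:R^-1 * a| <= e.
Proof.
move=> e0; near=> n.
have n0 : 0 < n%:R :> R by rewrite ltr0n; near: n; exists 1%N.
rewrite normrM gtr0_norm ?invr_gt0// ler_pdivrMl//.
have : `|a| / e <= n%:R by near: n; exact: nbhs_infty_ger.
by rewrite ler_pdivrMr// mulrC.
Unshelve. all: by end_near. Qed.

(** A finite limit excludes the values 0 and [+oo] of [M n] for large [n], as their scaled
    logarithms are infinite; the rest is exponentiation. *)
Lemma lne_scaled_cvg_bounds {R : realType} (M : nat -> \bar R) (L : R) :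
  (forall n, (0 <= M n)%E) ->
  ((n%:R^-1)%:E * lne (M n))%E @[n --> \oo] --> L%:E ->
  forall e, 0 < e -> \forall n \near \oo,
    exists2 m, M n = m%:E & expR (n%:R * (L - e)) <= m <= expR (n%:R * (L + e)).
Proof.
move=> M0 /fine_cvgP[fin /cvgrPdist_le cv] e e0.
near=> n.
have n0 : 0 < n%:R :> R by rewrite ltr0n; near: n; exists 1%N.
have fn : ((n%:R^-1)%:E * lne (M n))%E \is a fin_num by near: n.
have : `|L - fine ((n%:R^-1)%:E * lne (M n))%E| <= e by near: n; exact: cv.
have := M0 n; move: fn; case: (M n) => [r| |] //=; last first.
  by rewrite gt0_muley// lte_fin invr_gt0.
rewrite lee_fin => + r0.
case: ifPn => [|]; first by rewrite gt0_muleNy// lte_fin invr_gt0.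
rewrite -ltNge => {}r0 _ /=; rewrite ler_distlC => /andP[h1 h2].
exists r => //; rewrite -[r]lnK ?posrE// !ler_expR.
rewrite ler_pdivlMl// in h1; rewrite ler_pdivrMl// in h2.
by rewrite h1 h2.
Unshelve. all: by end_near. Qed.

(** The strict gaps give the exponential decay, under the tilt at [c], of the two tails at distance
    [e] from the slope. *)
Lemma derivable_chord_bounds {R : realType} (f : R -> R) (c e : R) :
  derivable f c 1 -> 0 < e ->
  exists2 s : R, 0 < s & f (c + s) < f c + s * ('D_1 f c + e) /\
    f (c - s) < f c - s * ('D_1 f c - e).
Proof.
move=> df e0; set y := 'D_1 f c.
have /cvgrPdist_lt/(_ _ e0) := df.
rewrite near_withinE => /nbhs_ballP[d /= d0 hd].
have key h : `|h| < d -> h != 0 -> `|f (c + h) - f c - h * y| < e * `|h|.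
  move=> hh h0.
  have := hd h; rewrite /ball/= sub0r normrN => /(_ hh h0).
  rewrite -/(derive f c 1) -/y /= [_%:A]mulr1 [h + c]addrC => h1.
  have -> : f (c + h) - f c - h * y = - (y - h^-1 * (f (c + h) - f c)) * h.
    by field.
  by rewrite normrM normrN ltr_pM2r ?normr_gt0.
exists (d / 2); first by rewrite divr_gt0.
have d2 : 0 < d / 2 by rewrite divr_gt0.
have := key (d / 2); have := key (- (d / 2)).
rewrite oppr_eq0 normrN !(gtr0_norm d2) gt_eqF// !ltr_norml.
move=> /(_ _ isT) k1 /(_ _ isT) k2.
have dd : d / 2 < d by lra.
have /andP[_ a1] := k1 dd; have /andP[_ a2] := k2 dd.
by split; lra.
Qed.

(* Penalising with [d * t ^+ 2 / 2] makes the infimum over [t] attained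
   without any hypothesis on the range of the derivative; the price is that the
   tilt points to [x - d * t], which is close to [x]. *)
Lemma legendre_tilt {R : realType} (f : R -> R) (x r e : R) :
  (forall t, derivable f t 1) -> f 0 = 0 -> 0 < e ->
  (forall t, x * t - f t <= r) ->
  exists2 c : R, `|'D_1 f c - x| <= e & 'D_1 f c * c - f c <= r.
Proof.
move=> df f0 e0 hr.
have r0 : 0 <= r by have := hr 0; rewrite f0; lra.
(* At the minimiser [d / 2 * c ^+ 2 <= r], so [(d * c) ^+ 2 <= 2 * d * r <= e ^+ 2]. *)
pose d := e ^+ 2 / (2 * (r + 1)).
have d0 : 0 < d by rewrite divr_gt0 ?exprn_gt0//; lra.
pose g t := f t + (d / 2 * t ^+ 2 - x * t).
have dg (t : R) : is_derive t 1 g ('D_1 f t + (d * t - x)).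
  have dft : is_derive t 1 f ('D_1 f t) by split.
  apply: is_derive_eq; rewrite /GRing.scale/=; lra.
(* Large enough that the same bound on [c] keeps the minimiser inside the open interval, where the
   derivative of [g] vanishes. *)
pose B := 1 + 2 * r / d.
have B1 : 1 <= B by rewrite /B lerDl divr_ge0//; lra.
have dB : r < d / 2 * B ^+ 2.
  have : d * B = d + 2 * r by rewrite /B; field; lra.
  by nra.
have cg : {within `[- B, B], continuous g}.
  by apply: derivable_within_continuous => t _; case: (dg t).
have BB : - B <= B by lra.
have [c cB cmin] := EVT_min BB cg.
have gc : g c <= 0.
  have -> : 0 = g 0 by rewrite /g f0; ring.
  by apply: cmin; rewrite in_itv/=; apply/andP; split; lra.
have hc : d / 2 * c ^+ 2 <= r by have := hr c; move: gc; rewrite /g; lra.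
have cB' : c \in `]- B, B[.
  rewrite in_itv/= -ltr_norml -(@ltr_pXn2r _ 2) ?nnegrE//; last by lra.
  by rewrite real_normK ?num_real// -(@ltr_pM2l _ (d / 2)); lra.
have : is_derive c 1 g 0.
  apply: (@derive1_at_min _ _ (- B) B) => // t tB.
  by apply: cmin; apply: subset_itv_oo_cc.
move=> [_ gc0]; case: (dg c) => _; rewrite gc0 => dE.
have Dc : 'D_1 f c = x - d * c by lra.
exists c; rewrite Dc.
  rewrite addrC addKr normrN -(@ler_pXn2r _ 2)// ?nnegrE//; last by lra.
  rewrite real_normK ?num_real//.
  have -> : (d * c) ^+ 2 = 2 * d * (d / 2 * c ^+ 2) by field.
  have : e ^+ 2 = 2 * d * (r + 1) by rewrite /d; field; lra.
  by move=> ->; apply: ler_wpM2l; lra.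
by have := hr c; have := sqr_ge0 c; nra.
Qed.

(** * Large deviation bounds from the limiting cumulant generating function *)

Section gartner_ellis.
Context d (T : measurableType d) (R : realType) (P : probability T R).
Context (Z : nat -> T -> R) (Lam : R -> R).
Context (mZ : forall n, measurable_fun setT (Z n)).
Context (dLam : forall t, derivable Lam t 1).
Context (cvgLam : forall t,
  ((n%:R^-1)%:E * lne 'E_P[fun w => expR (n%:R * t * Z n w)])%E @[n --> \oo]
  --> (Lam t)%:E).

Let M n t := (\int[P]_w (expR (n%:R * t * Z n w))%:E)%E.

Let M_ge0 n t : (0 <= M n t)%E.
Proof. by apply: integral_ge0 => w _; rewrite lee_fin expR_ge0. Qed.

Let measurable_exp n (a b : R) :
  measurable_fun setT (fun w => (expR (n%:R * a * Z n w + b))%:E : \bar R).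
Proof.
apply/measurable_EFinP; apply: measurableT_comp => //.
apply: measurable_funD => //; apply: measurable_funM => //.
Qed.

Let M_shift n (a b : R) :
  (\int[P]_w (expR (n%:R * a * Z n w + b))%:E = (expR b)%:E * M n a)%E.
Proof.
rewrite /M -ge0_integralZl//.
- by apply: eq_integral => w _; rewrite addrC expRD EFinM.
- by have := measurable_exp n a 0; under eq_fun do rewrite addr0.
Qed.

Let M_bounds t e : 0 < e -> \forall n \near \oo,
  exists2 m, M n t = m%:E &
    expR (n%:R * (Lam t - e)) <= m <= expR (n%:R * (Lam t + e)).
Proof.
apply: lne_scaled_cvg_bounds => [n|]; first exact: M_ge0.
have := cvgLam t; rewrite unlock; exact.
Qed.

Let Lam0 : Lam 0 = 0.
Proof.
have := cvgLam 0.
have -> : (fun n : nat =>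
    ((n%:R^-1)%:E * lne 'E_P[fun w => expR (n%:R * 0 * Z n w)])%E) =
    fun=> 0%E.
  apply/funext => n.
  have -> : (fun w => expR (n%:R * 0 * Z n w)) = cst 1.
    by apply/funext => w; rewrite mulr0 mul0r expR0.
  by rewrite expectation_cst lne1 mule0.
move=> c; apply: EFin_inj; apply/esym.
by apply: cvg_unique c => //; exact: cvg_cst.
Qed.

Let legendre_ge t x : ((x * t - Lam t)%:E <= legendre Lam x)%E.
Proof. by apply: ereal_sup_ubound; exists t. Qed.

(** Sublevel sets are intersections of closed conditions indexed by [t]; those for [t = 1] and
    [t = -1] already bound them. Nonnegativity is the case [t = 0]. *)
Lemma legendre_good_rate : good_rate_function (legendre Lam).
Proof.
split=> [x|a a0].
  by have := legendre_ge 0 x; rewrite mulr0 Lam0 subrr.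
have sublevelE : [set x | (legendre Lam x <= a%:E)%E] =
    \bigcap_(t in setT) [set x | x * t - Lam t <= a].
  apply/seteqP; split => [x /= h t _ /=|x /= h].
    by rewrite -lee_fin; apply: le_trans h; exact: legendre_ge.
  apply: ge_ereal_sup => _ [t _ <-]; rewrite lee_fin; exact: h.
apply: (@subclosed_compact _ _ `[- (a + Lam (-1)), a + Lam 1]).
- rewrite sublevelE; apply: closed_bigI => t _.
  suff : closed ((fun x : R => x * t - Lam t) @^-1` [set y | y <= a]) by [].
  apply: closed_comp.
    move=> x _; apply: cvgB; last exact: cvg_cst.
    by apply: cvgM; [exact: cvg_id|exact: cvg_cst].
  exact: closed_le.
- exact: segment_compact.
- rewrite sublevelE => x h /=; rewrite in_itv/=.
  by have := h 1 I; have := h (-1) I; move=> /= h1 h2; apply/andP; split; lra.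
Qed.

Let chernoff (s : seq R) (b e : R) : 0 < e -> \forall n \near \oo,
  (\sum_(t <- s) (expR (- (n%:R * (Lam t + b))))%:E * M n t
    <= ((size s)%:R * expR (n%:R * (e - b)))%:E)%E.
Proof.
move=> e0; elim: s => [|t s IH].
  by near=> n; rewrite big_nil mul0r.
near=> n; rewrite big_cons/= -natr1 [in leRHS]addrC mulrDl mul1r EFinD; apply: leeD.
  have [m -> /andP[_ m2]] : exists2 m, M n t = m%:E &
    expR (n%:R * (Lam t - e)) <= m <= expR (n%:R * (Lam t + e)).
    by near: n; exact: M_bounds.
  rewrite -EFinM lee_fin.
  apply: le_trans (ler_wpM2l (expR_ge0 _) m2) _.
  by rewrite -expRD ler_expR; lra.
by near: n.
Unshelve. all: by end_near. Qed.

(** The open sets where [x * t - Lam t > b] cover [C]. The tilts 1 and -1 handle points outside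
    [[-K, K]], compactness leaves finitely many tilts for the others, and the indicator of [C] is at
    most the sum of the corresponding exponentials, whose integrals are Chernoff bounds. *)
Lemma ldp_upper (C : set R) (b : R) : closed C ->
  (forall x, C x -> (b%:E < legendre Lam x)%E) ->
  exists k : nat, forall e, 0 < e -> \forall n \near \oo,
    (P (Z n @^-1` C) <= (k.+1%:R * expR (n%:R * (e - b)))%:E)%E.
Proof.
move=> cC hC.
have tilt x : C x -> exists t, b < x * t - Lam t.
  move=> /hC /ereal_sup_gt[_ [t _ <-]]; rewrite lte_fin => h.
  by exists t.
pose K := Num.max (b + Lam 1) (b + Lam (-1)).
have K1 : b + Lam 1 <= K by rewrite /K le_max lexx.
have K2 : b + Lam (-1) <= K by rewrite /K le_max lexx orbT.
have cA : compact (C `&` `[- K, K]).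
  apply: (@subclosed_compact _ _ `[- K, K]).
  - by apply: closedI => //; exact: itv_closed.
  - exact: segment_compact.
  - exact: subIsetr.
rewrite compact_cover in cA.
have [|x [Cx _]|D _ hD] := cA R setT (fun t => [set x | b < x * t - Lam t]).
- move=> t _.
  suff : open ((fun x : R => x * t - Lam t) @^-1` [set y | b < y]) by [].
  apply: open_comp.
    move=> x _; apply: cvgB; last exact: cvg_cst.
    by apply: cvgM; [exact: cvg_id|exact: cvg_cst].
  exact: open_gt.
- by have [t ht] := tilt x Cx; exists t.
pose s := [:: 1, -1 & enum_fset D].
have hs x : C x -> exists2 t, t \in s & b < x * t - Lam t.
  move=> Cx; have [xK|] := boolP (x \in `[- K, K]).
    have [t tD ht] := hD x (conj Cx xK); exists t => //.
    by rewrite !inE; apply/orP; right; apply/orP; right.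
  rewrite in_itv/= negb_and -!ltNge => /orP[h|h].
    by exists (-1); [rewrite !inE eqxx orbT|lra].
  by exists 1; [rewrite !inE eqxx|lra].
exists (size s).-1 => e e0; have := chernoff s b _ e0.
apply: filterS => n; apply: le_trans.
have mC : measurable (Z n @^-1` C).
  rewrite -[X in measurable X]setTI; apply: mZ => //.
  exact: closed_measurable.
rewrite -[Z n @^-1` C]setIT -integral_indic//.
under [leRHS]eq_bigr do rewrite -M_shift.
rewrite -ge0_integral_sum//.
apply: ge0_le_integral => //.
- by apply/measurable_EFinP; exact: measurable_indic.
- by apply: emeasurable_sum => t; exact: measurable_exp.
move=> w _; rewrite sumEFin lee_fin indicE.
have [|_] := boolP (w \in _); last by rewrite sumr_ge0.
rewrite inE => /hs[t ts ht].
rewrite (big_rem t)//= -[leLHS]addr0 lerD ?sumr_ge0//.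
rewrite leNgt expR_lt1 -leNgt.
rewrite (_ : _ + _ = n%:R * (Z n w * t - Lam t - b)); last by ring.
by rewrite mulr_ge0//; lra.
Qed.

(** The tilting argument, written as an inequality between moments instead of a change of measure:
    [M n c] splits according to whether [Z n] is within [del] of the slope [y]. The far part is
    exponentially smaller than [M n c], so the near part, controlled by the probability of [O],
    carries at least half of its lower bound. *)
Lemma ldp_lower (O : set R) (x r e : R) : open O -> O x ->
  (legendre Lam x <= r%:E)%E -> 0 < e -> \forall n \near \oo,
    ((2^-1 * expR (n%:R * (- r - e)))%:E <= P (Z n @^-1` O))%E.
Proof.
move=> oO Ox hr e0.
have /nbhs_ballP[eps /= eps0 hO] : nbhs x O by exact: open_nbhs_nbhs.
have hr' t : x * t - Lam t <= r.
  by rewrite -lee_fin; apply: le_trans hr; exact: legendre_ge.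
have eps2 : 0 < eps / 2 by rewrite divr_gt0.
have [c yx cr] := legendre_tilt _ _ _ _ dLam Lam0 eps2 hr'.
set y := 'D_1 Lam c in yx cr.
pose del := Num.min (eps / 2) (e / (4 * (`|c| + 1))).
have c1 : 0 < `|c| + 1 by rewrite ltr_wpDl.
have del0 : 0 < del by rewrite lt_min eps2 divr_gt0// mulr_gt0.
have dele : del <= eps / 2 by rewrite /del ge_min lexx.
have delc : `|c| * del <= e / 4.
  have : del <= e / (4 * (`|c| + 1)) by rewrite /del ge_min lexx orbT.
  rewrite ler_pdivlMr ?mulr_gt0// => h.
  by have := normr_ge0 c; nra.
have [s s0 [hp hm]] := derivable_chord_bounds _ _ _ (dLam c) del0.
rewrite -/y in hp hm.
(* The exponential rate lost by each tail; [eta] below is small enough that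
   [kap - 2 * eta >= kap / 2]. *)
pose kap := Num.min (Lam c + s * (y + del) - Lam (c + s))
                    (Lam c - s * (y - del) - Lam (c - s)).
have kap0 : 0 < kap by rewrite lt_min !subr_gt0 hp hm.
have kap1 : Lam (c + s) - s * (y + del) <= Lam c - kap.
  have : kap <= Lam c + s * (y + del) - Lam (c + s) by rewrite ge_min lexx.
  by lra.
have kap2 : Lam (c - s) + s * (y - del) <= Lam c - kap.
  have : kap <= Lam c - s * (y - del) - Lam (c - s).
    by rewrite /kap ge_min lexx orbT.
  by lra.
pose eta := Num.min (kap / 4) (e / 4).
have eta0 : 0 < eta by rewrite lt_min !divr_gt0.
have eta1 : eta <= kap / 4 by rewrite /eta ge_min lexx.
have eta2 : eta <= e / 4 by rewrite /eta ge_min lexx orbT.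
near=> n.
have n0 : 0 < n%:R :> R by rewrite ltr0n; near: n; exists 1%N.
have [m0 M0 /andP[m0l _]] : exists2 m, M n c = m%:E &
    expR (n%:R * (Lam c - eta)) <= m <= expR (n%:R * (Lam c + eta)).
  by near: n; exact: M_bounds.
have [m1 M1 /andP[_ m1u]] : exists2 m, M n (c + s) = m%:E &
    expR (n%:R * (Lam (c + s) - eta)) <= m <= expR (n%:R * (Lam (c + s) + eta)).
  by near: n; exact: M_bounds.
have [m2 M2 /andP[_ m2u]] : exists2 m, M n (c - s) = m%:E &
    expR (n%:R * (Lam (c - s) - eta)) <= m <= expR (n%:R * (Lam (c - s) + eta)).
  by near: n; exact: M_bounds.
have small : expR (n%:R * (Lam c - kap + eta)) <=
    4^-1 * expR (n%:R * (Lam c - eta)).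
  have : 4 / (kap / 2) <= n%:R by near: n; exact: nbhs_infty_ger.
  rewrite ler_pdivrMr ?divr_gt0// => hn.
  have h4 : 4 <= expR (n%:R * (kap / 2)).
    by apply: le_trans (expR_ge1Dx _); lra.
  rewrite ler_pdivlMl//.
  apply: le_trans (ler_wpM2r (expR_ge0 _) h4) _.
  by rewrite -expRD ler_expR -mulrDr ler_pM2l//; lra.
have mO : measurable (Z n @^-1` O).
  rewrite -[X in measurable X]setTI; apply: mZ => //.
  exact: open_measurable.
have [q Pq] : exists q, P (Z n @^-1` O) = q%:E.
  by exists (fine (P (Z n @^-1` O))); rewrite fineK// fin_num_measure.
(* Pointwise: if [z] is within [del] of [y] then [w] is in the event and
   [c * z <= c * y + |c| * del]; otherwise raising the tilt to [c + s] or lowering it to [c - s]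
   dominates the integrand. *)
have main : (M n c <=
    (expR (n%:R * (c * y + `|c| * del)))%:E * P (Z n @^-1` O) +
    ((expR (- (n%:R * (s * (y + del)))))%:E * M n (c + s) +
     (expR (n%:R * (s * (y - del))))%:E * M n (c - s)))%E.
  rewrite -[Z n @^-1` O]setIT -integral_indic// -!M_shift.
  have m1' : measurable_fun setT (fun w => (\1_(Z n @^-1` O) w : R)%:E).
    by apply/measurable_EFinP; exact: measurable_indic.
  have e0' a : (0 <= (expR a)%:E :> \bar R)%E by rewrite lee_fin expR_ge0.
  rewrite -ge0_integralZl// -[X in (_ + X)%E]ge0_integralD//.
  have f1_ge0 w : setT w -> (0 <= (expR (n%:R * (c * y + `|c| * del)))%:E *
      (\1_(Z n @^-1` O) w : R)%:E)%E.
    by move=> _; rewrite mule_ge0// lee_fin.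
  have f2_ge0 w : setT w ->
      (0 <= (expR (n%:R * (c + s) * Z n w - n%:R * (s * (y + del))))%:E +
            (expR (n%:R * (c - s) * Z n w + n%:R * (s * (y - del))))%:E)%E.
    by move=> _; rewrite adde_ge0.
  rewrite -(ge0_integralD _ _ f1_ge0 _ f2_ge0)//; last 2 first.
  - exact: measurable_funeM.
  - by apply: emeasurable_funD; exact: measurable_exp.
  apply: ge0_le_integral => //.
  - by have := measurable_exp n c 0; under eq_fun do rewrite addr0.
  - apply: emeasurable_funD; first exact: measurable_funeM.
    by apply: emeasurable_funD; exact: measurable_exp.
  move=> w _; rewrite -EFinM -!EFinD lee_fin.
  set z := Z n w.
  have e1 a : 0 <= expR a :> R := expR_ge0 a.
  have [zin|] := ltP `|z - y| del.
    rewrite indicE mem_set/=; last first.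
      apply: hO; rewrite /ball/= distrC.
      apply: le_lt_trans (ler_distD y _ _) _; lra.
    rewrite mulr1 -[leLHS]addr0 lerD ?addr_ge0// ler_expR -mulrA ler_pM2l//.
    have : c * (z - y) <= `|c| * del.
      apply: le_trans (ler_norm _) _; rewrite normrM.
      by apply: ler_wpM2l => //; exact: ltW.
    by lra.
  rewrite ler_normr => /orP[h|h].
    apply: (@le_trans _ _ (expR (n%:R * (c + s) * z - n%:R * (s * (y + del))))).
      by rewrite ler_expR -!mulrA -mulrBr ler_pM2l//; nra.
    by rewrite -[leLHS]add0r lerD ?mulr_ge0// -[leLHS]addr0 lerD.
  apply: (@le_trans _ _ (expR (n%:R * (c - s) * z + n%:R * (s * (y - del))))).
    by rewrite ler_expR -!mulrA -mulrDr ler_pM2l//; nra.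
  by rewrite -[leLHS]add0r lerD ?mulr_ge0// -[leLHS]add0r lerD.
move: main; rewrite M0 M1 M2 Pq -!EFinM -!EFinD !lee_fin => main.
have b1 : expR (- (n%:R * (s * (y + del)))) * m1 <=
    4^-1 * expR (n%:R * (Lam c - eta)).
  apply: le_trans (ler_wpM2l (expR_ge0 _) m1u) _; apply: le_trans small.
  by rewrite -expRD ler_expR -mulrN -mulrDr ler_pM2l//; lra.
have b2 : expR (n%:R * (s * (y - del))) * m2 <=
    4^-1 * expR (n%:R * (Lam c - eta)).
  apply: le_trans (ler_wpM2l (expR_ge0 _) m2u) _; apply: le_trans small.
  by rewrite -expRD ler_expR -mulrDr ler_pM2l//; lra.
have b3 : 2^-1 * expR (n%:R * (Lam c - eta)) <=
    expR (n%:R * (c * y + `|c| * del)) * q by lra.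
rewrite -(ler_pM2l (expR_gt0 (n%:R * (c * y + `|c| * del)))).
apply: le_trans b3; rewrite mulrCA ler_pM2l// -expRD ler_expR -mulrDr ler_pM2l//.
by lra.
Unshelve. all: by end_near. Qed.

Theorem gartner_ellis : large_deviation_principle P Z (legendre Lam).
Proof.
split=> [//||C cC|O oO]; first exact: legendre_good_rate.
(* A level [b] strictly between [a] and the infimum leaves room for the error [e] and the constant
   [k.+1]. Working with real [a] also covers an infinite infimum. *)
- have key (a : R) : (a%:E < ereal_inf (legendre Lam @` C))%E ->
      (limn_esup (fun n => (n%:R^-1)%:E * lne (P (Z n @^-1` C)))
       <= (- a)%:E)%E.
    move=> ha.
    have [b ab hb] : exists2 b, a < b &
        (b%:E < ereal_inf (legendre Lam @` C))%E.
      move: ha; case: ereal_inf => [i| |] //.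
        rewrite lte_fin => ai; exists ((a + i) / 2); first by lra.
        by rewrite lte_fin; lra.
      by move=> _; exists (a + 1); [lra|exact: ltry].
    have [|k hk] := @ldp_upper C b cC.
      move=> x Cx; apply: lt_le_trans hb _.
      by apply: ereal_inf_lbound; exists x.
    have e0 : 0 < (b - a) / 2 by lra.
    apply: limn_esup_le_near; near=> n.
    apply: (@le_trans _ _ (n%:R^-1 * ln k.+1%:R + ((b - a) / 2 - b))%:E).
      apply: lne_scaled_le => //; first by near: n; exists 1%N.
      by rewrite measure_ge0/=; near: n; exact: hk.
    rewrite lee_fin.
    have : `|n%:R^-1 * ln k.+1%:R| <= (b - a) / 2.
      by near: n; exact: near_div_small.
    by rewrite ler_norml => /andP[_]; lra.
  rewrite leeNr.
  have {}key (a : R) : (a%:E < ereal_inf (legendre Lam @` C))%E ->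
      (a%:E <= - limn_esup (fun n => (n%:R^-1)%:E * lne (P (Z n @^-1` C))))%E.
    by move/key; rewrite leeNr.
  move: key; case: ereal_inf => [i| |] key.
  + apply/lee_subgt0Pr => e e0; rewrite -EFinB; apply: key.
    by rewrite lte_fin; lra.
  + move: key; set l := (- _)%E; case: l => [l| |] key; rewrite ?leey//.
      by have := key (l + 1) (ltry _); rewrite lee_fin gerDl ler10.
    by have := key 0 (ltry _).
  + exact: leNye.
- rewrite leeNl; apply/ereal_infP => _ [x Ox <-]; rewrite leeNl.
  have [i0 _] := legendre_good_rate; have := i0 x.
  case E : (legendre Lam x) => [r| |] // _; last exact: leNye.
  rewrite -EFinN; apply/lee_subgt0Pr => e e0; rewrite -EFinB.
  apply: limn_einf_ge_near; near=> n.
  apply: (@le_trans _ _ (n%:R^-1 * ln 2^-1 + (- r - e / 2))%:E).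
    rewrite lee_fin.
    have : `|n%:R^-1 * ln 2^-1| <= e / 2 :> R.
      by near: n; apply: near_div_small; rewrite divr_gt0.
    by rewrite ler_norml => /andP[+ _]; lra.
  apply: lne_scaled_ge => //; first by near: n; exists 1%N.
  near: n; apply: ldp_lower oO Ox _ _; first by rewrite E.
  by rewrite divr_gt0.
Unshelve. all: by end_near. Qed.
End gartner_ellis.

(** * Moments of the random Fibonacci sequence *)

#[local] Arguments fib : simpl never.

(* [state_moment p t j k] is E[(c^-1 X_(n+j))^t] given that the pair
   (X_(n-1), X_n) is c (F_(k+2), F_(k+3)), i.e. that k zeros followed the last
   one. A further zero leads to [k.+1]; a one leads to (F_2, F_3) scaled by
   c F_(k+3). *)
Fixpoint state_moment {R : realType} (p t : R) (j k : nat) : R :=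
  if j is j'.+1 then
    (1 - p) * state_moment p t j' k.+1
    + p * expR (t * lnfib k) * state_moment p t j' 0
  else expR (t * lnfib k).

(** * Exponential growth of the state moments *)

Section harmonic.
Context {R : realType} (p t L : R) (hp : 0 < p < 1).
Context (aL : abscissa p t < L).
Context (sumL : infsum (renewal_term p t L) = 1).

Let hterm k i := p * (1 - p) ^+ i * expR (t * lnfib (k + i) - i.+1%:R * L).
(* Positive solution of
   exp(L) harm k = (1 - p) harm (k+1) + p F_(k+3)^t harm 0, normalised by
   [harm 0 = 1] (this is the implicit equation): an eigenfunction, with
   eigenvalue exp(L), of the recursion defining [state_moment]. *)
Let harm k := infsum (hterm k).

(** The sum of the geometric majorant of [hterm k] divided by [F_(k+3)^t], independent of [k] by
    [lnfib_shift]. *)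
Let B := p * expR (`|t| * lngolden - L) / (1 - expR (abscissa p t - L)).

Let r01 : 0 <= expR (abscissa p t - L) < 1.
Proof. by rewrite expR_ge0 expR_lt1 subr_lt0 aL. Qed.

Let B0 : 0 < B.
Proof.
have /andP[p0 p1] := hp; have /andP[r0 r1] := r01.
by rewrite divr_gt0 ?mulr_gt0 ?expR_gt0//; lra.
Qed.

Let hterm_ge0 k i : 0 <= hterm k i.
Proof.
have /andP[p0 p1] := hp.
by rewrite /hterm !mulr_ge0 ?expR_ge0 ?exprn_ge0//; lra.
Qed.

Let hterm_le k i : hterm k i <= expR (t * lnfib k) *
  (p * expR (`|t| * lngolden - L)) * expR (abscissa p t - L) ^+ i.
Proof.
have /andP[p0 p1] := hp.
have pq : 0 <= p * (1 - p) ^+ i by rewrite mulr_ge0 ?exprn_ge0//; lra.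
rewrite -(renewal_ratioE p hp) exprMn -expRM_natl.
set e1 := expR (t * lnfib k); set e2 := expR (_ - L); set e3 := expR (_ * _).
have -> : e1 * (p * e2) * ((1 - p) ^+ i * e3) =
  p * (1 - p) ^+ i * (e1 * e2 * e3) by ring.
apply: ler_wpM2l => //; rewrite -!expRD ler_expR -natr1.
have := lnfib_shift t k i; rewrite ler_norml => /andP[_]; lra.
Qed.

Let is_cvg_harm k : cvgn (series (hterm k)).
Proof.
apply: is_cvg_series_le_norm; last first.
  exact: (is_cvg_infsum_geometric (expR (t * lnfib k) *
    (p * expR (`|t| * lngolden - L))) _ r01).
by move=> i; rewrite ger0_norm.
Qed.

Let harm_le k : harm k <= B * expR (t * lnfib k).
Proof.
have -> : B * expR (t * lnfib k) = expR (t * lnfib k) *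
    (p * expR (`|t| * lngolden - L)) / (1 - expR (abscissa p t - L)).
  by rewrite /B; ring.
rewrite -(infsum_geometric _ _ r01); apply: le_infsum => //.
exact: is_cvg_infsum_geometric.
Qed.

Let harm_ge k : p * expR (- L) * expR (t * lnfib k) <= harm k.
Proof.
apply: le_trans (infsum_ge_head _ (is_cvg_harm k) (hterm_ge0 k)).
by rewrite /hterm addn0 expr0 mulr1 mul1r -mulrA -expRD addrC.
Qed.

Let harm0 : harm 0 = 1.
Proof. by rewrite -sumL. Qed.

(** The term [i = 0] splits off, and the remaining series is [(1 - p) * expR (- L)] times the one
    started at [k.+1]. *)
Let harm_rec k :
  expR L * harm k = p * expR (t * lnfib k) + (1 - p) * harm k.+1.
Proof.
have shiftE : (fun i => hterm k i.+1) =
    (fun i => (1 - p) * expR (- L) * hterm k.+1 i).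
  apply/funext => i; rewrite /hterm addSnnS exprS.
  rewrite (_ : t * _ - i.+2%:R * L = - L + (t * lnfib (k + i.+1) - i.+1%:R * L)).
    by rewrite expRD; ring.
  by rewrite -(natr1 i.+1); ring.
rewrite /harm infsum_recl shiftE; last exact: is_cvg_infsumZ.
rewrite infsumZ// /hterm addn0 expr0 mulr1 mul1r expRB expRN.
by field; rewrite expR_eq0.
Qed.

(** At [j = 0] the moments lie between two multiples of [harm]. The recursion has nonnegative
    coefficients, so it preserves both comparisons, while it multiplies [harm] exactly by
    [expR L]. *)
Lemma state_moment_bounds : exists a b : R, [/\ 0 < a, 0 < b &
  forall j, a * expR (j%:R * L) <= state_moment p t j 0
            <= b * expR (j%:R * L)].
Proof.
have /andP[p0 p1] := hp.
pose A := p * expR (- L).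
have A0 : 0 < A by rewrite mulr_gt0 ?expR_gt0.
exists B^-1, A^-1; rewrite !invr_gt0; split=> // j.
suff : forall k, B^-1 * expR (j%:R * L) * harm k <= state_moment p t j k
    <= A^-1 * expR (j%:R * L) * harm k.
  by move=> /(_ 0%N); rewrite harm0 !mulr1.
elim: j => [|j IH] k /=.
  rewrite mul0r expR0 !mulr1 ler_pdivrMl// ler_pdivlMl//.
  by rewrite harm_le harm_ge.
have step x : x * expR (j.+1%:R * L) * harm k =
    (1 - p) * (x * expR (j%:R * L) * harm k.+1) +
    p * expR (t * lnfib k) * (x * expR (j%:R * L) * harm 0).
  rewrite harm0 mulr1 -natr1 mulrDl mul1r expRD -!mulrA harm_rec; ring.
have /andP[a1 b1] := IH k.+1; have /andP[a2 b2] := IH 0%N.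
have q0 : 0 <= 1 - p by lra.
have pe : 0 <= p * expR (t * lnfib k) by rewrite mulr_ge0 ?expR_ge0// ltW.
by rewrite !step; apply/andP; split; apply: lerD; exact: ler_wpM2l.
Qed.

End harmonic.

(** * Moments of the sequence through finite words *)

Section cylinders.
Context {d : measure_display} {T : measurableType d} {R : realType}.
Context (P : probability T R) (p : R) (hp : 0 < p < 1).
Context (theta : nat -> {RV P >-> bool}) (X : nat -> {RV P >-> R}).
Context (hX : bernoulli_fibonacci P p theta X).

Definition bernoulli_weight (b : bool) : R := if b then p else 1 - p.

Definition word_weight (s : seq bool) : R := \prod_(b <- s) bernoulli_weight b.

Definition cylinder (s : seq bool) : set T :=
  [set w | forall i, (i < size s)%N -> theta (i + 3) w = nth false s i].

Definition run_step (xy : R * R) (b : bool) : R * R :=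
  (xy.2, xy.2 + if b then xy.2 else xy.1).

Definition run (s : seq bool) : R * R := foldl run_step (1, 2) s.

(** The conditional moment of order [t], [j] steps ahead, given that the last two values of the
    sequence are [xy]. *)
Fixpoint run_moment (t : R) (j : nat) (xy : R * R) : R :=
  if j is j'.+1 then
    (1 - p) * run_moment t j' (run_step xy false)
    + p * run_moment t j' (run_step xy true)
  else xy.2 `^ t.

Lemma cylinder_nil : cylinder [::] = setT.
Proof. by apply/seteqP; split. Qed.

Lemma cylinder_rcons s b : cylinder (rcons s b) =
  cylinder s `&` theta (size s + 3) @^-1` [set b].
Proof.
apply/seteqP; split => w.
  move=> h; split => /=.
    move=> i si; rewrite h ?size_rcons 1?ltnW// nth_rcons si//.
  by rewrite h ?size_rcons// nth_rcons ltnn eqxx.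
move=> [h /= hb] i; rewrite size_rcons ltnS leq_eqVlt => /orP[/eqP ->|si].
  by rewrite hb nth_rcons ltnn eqxx.
by rewrite h// nth_rcons si.
Qed.

Lemma measurable_cylinder s : measurable (cylinder s).
Proof.
elim/last_ind: s => [|s b IH]; first by rewrite cylinder_nil.
rewrite cylinder_rcons; apply: measurableI => //.
by rewrite -[X in measurable X]setTI; exact: measurable_funPT.
Qed.

Lemma mem_index_window n i :
  [set` seq_fset tt (iota 3 n)] i <-> (3 <= i < 3 + n)%N.
Proof.
rewrite -[X in X <-> _]/(is_true (i \in seq_fset tt (iota 3 n))).
by rewrite seq_fsetE mem_iota.
Qed.

(** The form required by [mutually_independent]: letter [i - 3] of the word constrains [theta i]. *)
Lemma cylinder_bigcap s : cylinder s =
  \bigcap_(i in [set` seq_fset tt (iota 3 (size s))])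
    theta i @^-1` [set nth false s (i - 3)].
Proof.
apply/seteqP; split => w h i.
  move=> /mem_index_window/andP[i3 is3] /=.
  have := h (i - 3)%N; rewrite subnK// => -> //.
  by rewrite ltn_subLR.
move=> si; have := h (i + 3)%N; rewrite addnK; apply.
by apply/mem_index_window; rewrite leq_addl addnC ltn_add2l.
Qed.

Lemma probability_theta n b : (3 <= n)%N ->
  P (theta n @^-1` [set b]) = (bernoulli_weight b)%:E.
Proof.
move=> n3; have /andP[p0 p1] := hp.
have [_ dist _ _] := hX.
have := dist n n3 [set b]; rewrite /distribution /pushforward => ->.
rewrite bernoulli_probE ?(ltW p0) ?(ltW p1)// !diracE.
case: b; rewrite /bernoulli_weight.
  by rewrite mem_set// memNset//= mule1 mule0 adde0.
by rewrite memNset// mem_set//= mule1 mule0 add0e.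
Qed.

Lemma probability_cylinder s : P (cylinder s) = (word_weight s)%:E.
Proof.
have [indep _ _ _] := hX.
rewrite cylinder_bigcap.
rewrite (indep (seq_fset tt (iota 3 (size s)))
  (fun i => [set nth false s (i - 3)])); last 2 first.
- by move=> i /mem_index_window/andP[].
- by [].
have -> : (\prod_(i <- seq_fset tt (iota 3 (size s)))
    P (theta i @^-1` [set nth false s (i - 3)]) =
  \prod_(i <- iota 3 (size s))
    P (theta i @^-1` [set nth false s (i - 3)]))%E.
  apply: perm_big; apply: perm_trans (seq_fset_perm _ _) _.
  by rewrite undup_id// iota_uniq.
rewrite (eq_big_seq (fun i => (bernoulli_weight (nth false s (i - 3)))%:E));
  last by move=> i; rewrite mem_iota => /andP[i3 _]; exact: probability_theta.
rewrite /word_weight (big_nth false) /index_iota subn0.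
rewrite -[3%N]addn0 iotaDl big_map prodEFin; congr (_%:E).
by apply: eq_bigr => i _; rewrite addKn.
Qed.

Lemma word_weight_rcons s b :
  word_weight (rcons s b) = word_weight s * bernoulli_weight b.
Proof. by rewrite /word_weight -cats1 big_cat big_seq1. Qed.

Lemma run_rcons s b : run (rcons s b) = run_step (run s) b.
Proof. by rewrite /run -cats1 foldl_cat. Qed.

Lemma run_on_cylinder s w : cylinder s w ->
  (X (size s).+1 w, X (size s).+2 w) = run s.
Proof.
have [_ _ init rec] := hX.
elim/last_ind: s => [_|s b IH].
  by have [_ -> ->] := init w.
rewrite cylinder_rcons => -[/IH runE /= thb].
rewrite run_rcons -runE /run_step/= size_rcons; congr (_, _).
rewrite rec// -(addn3 (size s)) thb.
by case: b {thb} => /=; rewrite ?addnK// addn0 subn1.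
Qed.

Lemma X_ge1 n w : 1 <= X n w.
Proof.
have [_ _ init rec] := hX.
suff : 1 <= X n w /\ 1 <= X n.+1 w by case.
elim: n => [|n [IH1 IH2]]; first by have [-> -> _] := init w; rewrite lexx.
split => //; case: n IH1 IH2 => [|n] IH1 IH2.
  by have [_ _ ->] := init w; lra.
rewrite rec//; case: (theta _ _) => /=; rewrite ?addnK ?addn0 ?subn1/=; lra.
Qed.

Lemma measurable_powR_X n t (D : set T) : measurable D ->
  measurable_fun D (fun w => (X n w `^ t)%:E).
Proof.
move=> mD; apply/measurable_EFinP; apply: measurable_funTS.
exact: (measurableT_comp (measurable_powR t)).
Qed.

(** Induction on the number of steps left, splitting the cylinder by the next letter; with no step
    left the integrand is constant on it. *)
Lemma integral_cylinder t j s :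
  (\int[P]_(w in cylinder s) (X (j + size s).+2 w `^ t)%:E =
   (word_weight s * run_moment t j (run s))%:E)%E.
Proof.
elim: j s => [|j IH] s.
  rewrite (eq_integral (cst (((run s).2) `^ t)%:E)); last first.
    move=> w; rewrite inE => /run_on_cylinder <-.
    by rewrite add0n.
  rewrite integral_cst; last exact: measurable_cylinder.
  by rewrite mulrC EFinM; congr (_ * _)%E; exact: probability_cylinder.
have -> : cylinder s = cylinder (rcons s false) `|` cylinder (rcons s true).
  rewrite !cylinder_rcons -setIUr; apply/esym/setIidPl => w _ /=.
  by case: (theta _ _); [right|left].
have E b : (j.+1 + size s = j + size (rcons s b))%N.
  by rewrite size_rcons addSnnS.
rewrite ge0_integral_setU.
- rewrite {1}(E false) (E true) !IH -EFinD !word_weight_rcons !run_rcons/=.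
  by congr (_%:E); ring.
- exact: measurable_cylinder.
- exact: measurable_cylinder.
- by apply: measurable_powR_X; apply: measurableU; exact: measurable_cylinder.
- by move=> w _; rewrite lee_fin powR_ge0.
- rewrite disj_set2E; apply/eqP; rewrite !cylinder_rcons.
  by apply/seteqP; split => // w [[_ /= ->] [_ /=]].
Qed.

(** Homogeneity extracts the scale: a zero raises [k] and keeps [c], while a one yields
    [c * F_(k+3)] times [(1, 2) = (F_2, F_3)], that is, state 0. *)
Lemma run_moment_fib t j k (c : R) : 0 < c ->
  run_moment t j (c * (fib k.+2)%:R, c * (fib k.+3)%:R) =
  c `^ t * state_moment p t j k.
Proof.
elim: j k c => [|j IH] k c c0.
  by rewrite /= expR_lnfib addn3 powRM// ltW.
have f0 : 0 < (fib k.+3)%:R :> R by rewrite ltr0n fib_gt0.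
rewrite [LHS]/= [state_moment _ _ _ _]/= /run_step [_.1]/= [_.2]/=.
have -> : c * (fib k.+3)%:R + c * (fib k.+2)%:R = c * (fib k.+4)%:R.
  by rewrite -mulrDr -natrD -fibSS.
rewrite IH//.
have -> : (c * (fib k.+3)%:R, c * (fib k.+3)%:R + c * (fib k.+3)%:R) =
   (c * (fib k.+3)%:R * (fib 2)%:R, c * (fib k.+3)%:R * (fib 3)%:R).
  by rewrite (_ : fib 2 = 1%N)// (_ : fib 3 = 2%N)//; congr (_, _); ring.
rewrite IH ?mulr_gt0// powRM ?ltW// expR_lnfib addn3; ring.
Qed.

Lemma expectation_powR t j :
  ('E_P[fun w => (X j.+2 w `^ t)%R] = (state_moment p t j 0)%:E)%E.
Proof.
rewrite unlock -cylinder_nil.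
have := integral_cylinder t j [::]; rewrite /= addn0 => ->.
rewrite /word_weight big_nil mul1r.
have := run_moment_fib t j 0 1 ltr01.
by rewrite powR1 !mul1r /run/= => <-.
Qed.

End cylinders.

(** * From expectations to real series, and conclusion *)

Lemma expectation_geometric {d : measure_display} {T : measurableType d}
    {R : realType} (Q : probability T R) (p : R) (G : {RV Q >-> nat})
    (g : nat -> R) : geometric_rv Q p G -> (forall k, 0 <= g k) ->
  ('E_Q[fun w => g (G w)] =
   \sum_(0 <= k <oo) (p * (1 - p) ^+ k * g k)%:E)%E.
Proof.
move=> hG g0.
have mF k : measurable (G @^-1` [set k]).
  by rewrite -[X in measurable X]setTI; exact: measurable_funPT.
have covT : setT = \bigcup_k (G @^-1` [set k]).
  by apply/seteqP; split => // w _; exists (G w).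
rewrite unlock {1}covT ge0_integral_bigcup//.
- apply: eq_eseriesr => k _.
  rewrite (eq_integral (cst (g k)%:E)); last by move=> w; rewrite inE => /= ->.
  rewrite integral_cst// [X in X = _](_ : _ = (g k)%:E * (p * (1 - p) ^+ k)%:E)%E.
    by rewrite -EFinM mulrC.
  by congr (_ * _)%E; exact: hG.
- rewrite -covT; apply/measurable_EFinP.
  apply: measurableT_comp => //; exact: measurable_funPT.
- by move=> w _; rewrite lee_fin.
- by move=> i j _ _ [w [/= <- <-]].
Qed.

(** A finite extended-real sum encodes convergence too, so an arbitrary solution of the implicit
    equation comes with a convergent real series. *)
Lemma nneseries_EFin {R : realType} (u : R ^nat) : (forall k, 0 <= u k) ->
  forall x : R, (\sum_(0 <= k <oo) (u k)%:E = x%:E)%E <->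
    cvgn (series u) /\ infsum u = x.
Proof.
move=> u0 x.
have E : cvgn (series u) -> (\sum_(0 <= k <oo) (u k)%:E = (infsum u)%:E)%E.
  move=> cu; rewrite /infsum -EFin_lim//.
  suff -> : EFin \o series u = (fun n => \sum_(0 <= k < n) (u k)%:E)%E by [].
  by apply/funext => n; rewrite /= sumEFin.
split=> [h|[cu <-]]; last exact: E.
have cu : cvgn (series u).
  apply: nondecreasing_is_cvgn; first exact: nondecreasing_series.
  exists x => _ [n _ <-]; rewrite -lee_fin -h /series/= -sumEFin.
  by apply: nneseries_lim_ge => k _ _; rewrite lee_fin.
by split => //; apply: EFin_inj; rewrite -E.
Qed.

(** The index shift [k] only changes the constants by [expR (- (k%:R * L))], and constants vanish
    after division of the logarithm by [n]. *)
Lemma lne_scaled_cvg {R : realType} (M : nat -> \bar R) (L a b : R) (k : nat) :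
  0 < a -> 0 < b ->
  (forall j, exists2 m, M (j + k)%N = m%:E &
    a * expR (j%:R * L) <= m <= b * expR (j%:R * L)) ->
  ((n%:R^-1)%:E * lne (M n))%E @[n --> \oo] --> L%:E.
Proof.
move=> a0 b0 hM.
have E (c : R) n : (k <= n)%N ->
    c * expR ((n - k)%:R * L) = c * expR (- (k%:R * L)) * expR (n%:R * L).
  by move=> kn; rewrite -mulrA -expRD natrB//; congr (_ * expR _); ring.
have lim (c : R) : (n%:R^-1 * ln (c * expR (- (k%:R * L))) + L)%:E
    @[n --> \oo] --> L%:E.
  apply: cvg_EFin; first exact: nearW.
  apply/cvgrPdist_le => e e0; have := near_div_small (ln (c * expR (- (k%:R * L)))) e e0.
  apply: filterS => n; rewrite /= opprD addrCA subrr addr0 normrN; exact.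
apply: squeeze_cvge (lim a) (lim b); near=> n.
have n0 : (0 < n)%N by near: n; exists 1%N.
have kn : (k <= n)%N by near: n; exists k.
have [m] := hM (n - k)%N; rewrite subnK// => ->; rewrite (E a n kn) (E b n kn) => /andP[m1 m2].
apply/andP; split.
  by apply: lne_scaled_ge => //; rewrite mulr_gt0 ?expR_gt0.
apply: lne_scaled_le => //; first by rewrite mulr_gt0 ?expR_gt0.
rewrite !lee_fin m2 andbT; apply: le_trans m1.
by rewrite !mulr_ge0 ?expR_ge0// ltW.
Unshelve. all: by end_near. Qed.

Theorem theorem3p3 (R : realType) (p : R) (hp : 0 < p < 1)
    (d : measure_display) (T : measurableType d) (P : probability T R)
    (theta : nat -> {RV P >-> bool}) (X : nat -> {RV P >-> R})
    (hX : bernoulli_fibonacci P p theta X)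
    (d' : measure_display) (T' : measurableType d') (Q : probability T' R)
    (G : {RV Q >-> nat}) (hG : geometric_rv Q p G) :
  exists Lambda : R -> R,
    [/\ forall t : R,
          unique (fun L : R =>
            ('E_Q[fun w => ((fib (G w + 3))%:R `^ t
                           * expR (- ((G w + 1)%:R * L)))%R] = 1)%E)
            (Lambda t),
        forall t : R,
          ((n%:R^-1)%:E * lne ('E_P[fun w => (X n w `^ t)%R]))%E @[n --> \oo]
            --> (Lambda t)%:E &
        large_deviation_principle P (fun n w => n%:R^-1 * ln (X n w))
          (legendre Lambda)].
Proof.
have /choice[Lam hLam] : forall t, exists L,
    abscissa p t < L /\ infsum (renewal_term p t L) = 1.
  by move=> t; have [L aL sL] := renewal_solution p hp t; exists L.
have aLam t : abscissa p t < Lam t by case: (hLam t).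
have sLam t : infsum (renewal_term p t (Lam t)) = 1 by case: (hLam t).
have cLam t := is_cvg_renewal p hp t _ (aLam t).
have EG t L : ('E_Q[fun w => ((fib (G w + 3))%:R `^ t
      * expR (- ((G w + 1)%:R * L)))%R] = 1)%E <->
    cvgn (series (renewal_term p t L)) /\ infsum (renewal_term p t L) = 1.
  rewrite -nneseries_EFin; last by move=> k; rewrite ltW ?renewal_term_gt0.
  rewrite (expectation_geometric Q p G (fun k => (fib (k + 3))%:R `^ t
      * expR (- ((k + 1)%:R * L))) hG); last first.
    by move=> k; rewrite mulr_ge0 ?powR_ge0 ?expR_ge0.
  rewrite (eq_eseriesr (g := fun k => (renewal_term p t L k)%:E))//.
  by move=> k _; rewrite /renewal_term expRD expR_lnfib addn1.
have cvgX t : ((n%:R^-1)%:E * lne ('E_P[fun w => (X n w `^ t)%R]))%E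
    @[n --> \oo] --> (Lam t)%:E.
  have [a [b [a0 b0 hab]]] := state_moment_bounds p t _ hp (aLam t) (sLam t).
  apply: (lne_scaled_cvg _ _ a b 2 a0 b0) => j.
  exists (state_moment p t j 0) => //.
  by rewrite addn2 (expectation_powR P p hp theta X hX).
exists Lam; split => // [t|].
  split; first exact/EG.
  move=> L /EG[cL sL]; apply/eqP; rewrite eq_le !leNgt.
  apply/andP; split; apply/negP => lt.
    by have := renewal_sum_decreasing p hp t _ _ lt cL; rewrite sLam sL ltxx.
  by have := renewal_sum_decreasing p hp t _ _ lt (cLam t); rewrite sLam sL ltxx.
apply: gartner_ellis.
- move=> n; apply: measurable_funM => //.
  by apply: measurableT_comp => //; exact: measurable_ln.
- exact: (renewal_root_derivable p hp Lam aLam sLam).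
(* As [X n w] is positive, [expR (n * t * (ln X / n))] is its power [t] once [n] is cancelled, which
   uses [n != 0]. *)
move=> t; apply: cvg_trans (cvgX t); apply: near_eq_cvg; near=> n.
have n0 : n%:R != 0 :> R by rewrite pnatr_eq0 -lt0n; near: n; exists 1%N.
congr (_ * lne 'E_P[_])%E; apply/funext => w.
have X0 : 0 < X n w by apply: lt_le_trans (X_ge1 P p theta X hX n w).
rewrite /powR gt_eqF//; congr expR; field.
Unshelve. all: by end_near. Qed.
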